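(* Let $f$ be an arithmetic function such that $\widetilde{f}(n) := \sum_{d\mid n} f(d) \neq 0$ for all $n \geq 1$. For $n,k \geq 1$ let \[ s_{n,k}(f) := [q^n]\, (q;q)_\infty \sum_{m \geq 1} T_{\mathrm{Div}}(m,k)\,\widetilde{f}(m)\, q^m , \] which is the unique array (independent of $g$) such that for every arithmetic function $g$, $\sum_{n \geq 1} \frac{a_{fg}(n) q^n}{1-q^n} = \frac{1}{(q;q)_\infty}\sum_{n\geq 1}\sum_{k=1}^n s_{n,k}(f) g(k) q^n$, where $a_{fg}(n) := \sum_{d\mid n}\widetilde f(d)\widetilde g(d)\mu(n/d)$ and $\widetilde g(n):=\sum_{d\mid n} g(d)$. Then the lower-triangular matrix $(s_{n,k}(f))_{n,k \geq 1}$ is invertible, and the entries of its inverse are \[ s_{n,k}^{(-1)}(f) = \sum_{d \mid n} \frac{p(d-k)}{\widetilde{f}(d)}\, \mu(n/d), \qquad n,k \geq 1 . \]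
   Context: Arithmetic functions are maps $\mathbb{Z}_{>0}\to\mathbb{C}$; $\mu$ is the Möbius function; $p(m)$ is the number of partitions of $m$, with $p(0)=1$ and $p(m)=0$ for $m<0$. $(q;q)_\infty := \prod_{m\ge1}(1-q^m)$. $T_{\mathrm{Div}}(m,k)=1$ if $k\mid m$ and $0$ otherwise. $[q^n]$ denotes extraction of the coefficient of $q^n$. *)

(* Defs.v *)
From HB Require Import structures.
From mathcomp Require Import all_boot all_order all_algebra.
From mathcomp Require Import complex.
From mathcomp Require Import reals.

Set Implicit Arguments.
Unset Strict Implicit.
Unset Printing Implicit Defensive.

Import GRing.Theory.
Local Open Scope ring_scope.

(** * Formal power series, given by their coefficient sequences *)

Definition fps (F : Type) : Type := nat -> F.

Definition fps_of_poly (F : fieldType) (p : {poly F}) : fps F := fun n => p`_n.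

Definition fps_mul (F : fieldType) (a b : fps F) : fps F :=
  fun n => \sum_(i < n.+1) a i * b (n - i)%N.

(* The first n coefficients of 1 / a, obtained by solving a * b = 1 degree by
   degree; meaningful when a 0 != 0, see [fps_mulV]. *)
Fixpoint fps_inv_seq (F : fieldType) (a : fps F) (n : nat) : seq F :=
  if n is m.+1 then
    let s := fps_inv_seq a m in
    rcons s ((a 0%N)^-1 * ((m == 0%N)%:R - \sum_(i < m) a (m - i)%N * s`_i))
  else [::].

Definition fps_inv (F : fieldType) (a : fps F) : fps F :=
  fun n => (fps_inv_seq a n.+1)`_n.

(* sum_(m >= 1) c m * q^m, with zero constant term whatever c 0 is. *)
Definition gen_series (F : fieldType) (c : nat -> F) : fps F :=
  fun m => if (0 < m)%N then c m else 0.

(* Convergence in the q-adic topology. *)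
Definition fps_cvg (F : fieldType) (u : nat -> fps F) (l : fps F) : Prop :=
  forall m, exists N0, forall N, (N0 <= N)%N -> u N m = l m.

(* (q;q)_oo: the factors with index > n do not change the coefficient of q^n,
   see [qq_inf_cvg]. *)
Definition qq_inf (F : fieldType) : fps F :=
  fun n => (\prod_(1 <= m < n.+1) (1 - 'X^m) : {poly F})`_n.

Definition lambert_term (F : fieldType) (n : nat) : fps F :=
  fps_mul (fps_of_poly 'X^n) (fps_inv (fps_of_poly (1 - 'X^n))).

(* sum_(n >= 1) a n * q^n / (1 - q^n): the terms with index > m do not change
   the coefficient of q^m, see [lambert_cvg]. *)
Definition lambert (F : fieldType) (a : nat -> F) : fps F :=
  fun m => \sum_(1 <= n < m.+1) a n * lambert_term F n m.

Lemma size_fps_inv_seq (F : fieldType) (a : fps F) n :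
  size (fps_inv_seq a n) = n.
Proof. by elim: n => //= n IHn; rewrite size_rcons IHn. Qed.

Lemma nth_fps_inv_seq (F : fieldType) (a : fps F) n i : (i < n)%N ->
  (fps_inv_seq a n)`_i = fps_inv a i.
Proof.
elim: n => //= n IHn; rewrite ltnS leq_eqVlt => /predU1P [-> //|ltin].
by rewrite nth_rcons size_fps_inv_seq ltin IHn.
Qed.

Lemma fps_mulV (F : fieldType) (a : fps F) : a 0%N != 0 ->
  fps_mul a (fps_inv a) =1 fps_of_poly 1.
Proof.
move=> a0 n; rewrite /fps_mul big_ord_recl subn0 /fps_of_poly coef1 /=.
rewrite {1}/fps_inv /= nth_rcons size_fps_inv_seq ltnn eqxx mulVKf //.
rewrite -[RHS]addr0 -addrA; congr (_ + _); rewrite addrC; apply/eqP.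
rewrite subr_eq0; apply/eqP; rewrite (reindex_inj rev_ord_inj) /=.
apply: eq_bigr => i _; rewrite nth_fps_inv_seq // /bump /= add1n subnSK //.
by rewrite subKn // ltnW.
Qed.

Lemma qq_inf_cvg (F : fieldType) :
  fps_cvg (fun N => fps_of_poly (\prod_(1 <= m < N.+1) (1 - 'X^m)))
          (qq_inf F).
Proof.
move=> m; exists m => N /subnK <-; elim: (N - m)%N => // k IHk.
rewrite -IHk /fps_of_poly addSn big_nat_recr //= mulrBr mulr1 coefB coefMXn.
by rewrite ltnS leq_addl subr0.
Qed.

Lemma lambert_cvg (F : fieldType) (a : nat -> F) :
  fps_cvg (fun N m => \sum_(1 <= n < N.+1) a n * lambert_term F n m)
          (lambert a).
Proof.
move=> m; exists m => N /subnK <-; elim: (N - m)%N => // k IHk.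
rewrite -IHk addSn big_nat_recr //= [X in a _ * X]big1 ?mulr0 ?addr0 // => i _.
rewrite /fps_of_poly coefXn; have := ltn_ord i; rewrite ltnS => lim.
by rewrite ltn_eqF ?mul0r // ltnS (leq_trans lim) // leq_addl.
Qed.

(** * Arithmetic functions

   An arithmetic function is a map [nat -> F] of which only the values at
   positive integers are ever used ([divisors n] never contains 0). *)

Definition div_sum (F : fieldType) (f : nat -> F) (n : nat) : F :=
  \sum_(d <- divisors n) f d.

Definition moebius (F : fieldType) (n : nat) : F :=
  if all (fun p => logn p n == 1%N) (primes n)
  then (-1) ^+ size (primes n) else 0.

Definition T_Div (F : fieldType) (m k : nat) : F := (k %| m)%N%:R.

(* a_{fg}; it is a function of f and g, not of their product. *)
Definition a_fg (F : fieldType) (f g : nat -> F) (n : nat) : F :=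
  \sum_(d <- divisors n) div_sum f d * div_sum g d * moebius F (n %/ d).

Definition s_mat (F : fieldType) (f : nat -> F) (n k : nat) : F :=
  fps_mul (qq_inf F) (gen_series (fun m => T_Div F m k * div_sum f m)) n.

(** * Integer partitions *)

Definition is_partition (n : nat) (s : seq nat) : bool :=
  [&& sorted geq s, 0%N \notin s & sumn s == n].

(* A partition of n has at most n parts, each at most n, so that restricting to
   the finite type of such sequences loses nothing, see [partition_bounded]. *)
Definition npart (n : nat) : nat :=
  #|[set s : n.-bseq 'I_n.+1 | is_partition n [seq val i | i <- s]]|.

Definition npartz (m : int) : nat := if m is Posz n then npart n else 0%N.

Lemma partition_bounded n (s : seq nat) : is_partition n s ->
  exists t : n.-bseq 'I_n.+1, [seq val i | i <- t] = s.
Proof.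
case/and3P => _ s_gt0 /eqP sum_s.
have szs : (size s <= n)%N.
  rewrite -sum_s; elim: s s_gt0 {sum_s} => //= x s IHs.
  rewrite inE negb_or eq_sym -lt0n => /andP [x0 /IHs les].
  by rewrite -add1n leq_add.
have les x : x \in s -> (x <= n)%N.
  rewrite -sum_s; elim: s {s_gt0 sum_s szs} => //= y s IHs.
  rewrite inE => /predU1P [-> | /IHs lex]; first exact: leq_addr.
  exact: leq_trans lex (leq_addl _ _).
have szt : (size [seq (inord x : 'I_n.+1) | x <- s] <= n)%N by rewrite size_map.
exists (Bseq szt); rewrite /= -map_comp -[RHS]map_id; apply/eq_in_map => x xs.
by rewrite /= inordK // ltnS les.
Qed.

(** * Infinite lower-triangular matrices, with rows and columns indexed by the
   positive integers *)

Definition lower_triangular (F : fieldType) (A : nat -> nat -> F) : Prop :=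
  forall n k, (0 < n)%N -> (n < k)%N -> A n k = 0.

(* Row n of a lower-triangular A vanishes beyond column n, so the matrix product
   is a finite sum. *)
Definition lt_mul (F : fieldType) (A B : nat -> nat -> F) (n k : nat) : F :=
  \sum_(1 <= j < n.+1) A n j * B j k.

Definition lt_is_inverse (F : fieldType) (A B : nat -> nat -> F) : Prop :=
  lower_triangular B /\
  forall n k, (0 < n)%N -> (0 < k)%N ->
    lt_mul A B n k = (n == k)%:R /\ lt_mul B A n k = (n == k)%:R.

Definition lt_invertible (F : fieldType) (A : nat -> nat -> F) : Prop :=
  lower_triangular A /\ exists B, lt_is_inverse A B.

(** * The factorization property characterizing [s_mat] *)

Definition lambert_factorization (F : fieldType) (f : nat -> F)
    (s : nat -> nat -> F) : Prop :=
  forall (g : nat -> F) (n : nat),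
    lambert (a_fg f g) n =
    fps_mul (fps_inv (qq_inf F))
      (gen_series (fun m => \sum_(1 <= k < m.+1) s m k * g k)) n.

(* Main.v *)
Require Import Defs.
From HB Require Import structures.
From mathcomp Require Import all_boot all_order all_algebra.
From mathcomp Require Import complex.
From mathcomp Require Import reals.

Set Implicit Arguments.
Unset Strict Implicit.
Unset Printing Implicit Defensive.

Import GRing.Theory.
Local Open Scope ring_scope.

(**
  Write T(a) for the lower-triangular Toeplitz matrix of a power series a, D for
  the divisibility matrix and h for the divisor sum of f.  By definition
  s = T((q;q)_oo) diag(h) D.  Each factor has an explicit inverse:
  T((q;q)_oo)^-1 is the Toeplitz matrix of the partition numbers (Euler),
  and D^-1 has entries mu(n/k) for k | n (Moebius inversion).  Hence
  s^-1 = D^-1 diag(1/h) T(p), which is the stated formula.  Since a Lambert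
  series has coefficients D a, the series of a_fg has coefficients
  h(n) (D g)(n), so the factorization is T(p) s = diag(h) D, and taking for g an
  indicator function recovers each column of s.
*)

(** * Lower-triangular matrices *)

Section LowerTriangular.

Variable F : fieldType.
Implicit Types A B C : nat -> nat -> F.

Definition lt_one (n k : nat) : F := (n == k)%:R.

Definition lt_diag (h : nat -> F) (n k : nat) : F := (n == k)%:R * h n.

(** Rows and columns start at 1; values at index 0 carry no meaning and are left out of the
    comparison. *)
Definition lt_eq A B := forall n k, (0 < n)%N -> (0 < k)%N -> A n k = B n k.

Lemma lt_mul_widen A B n k N : lower_triangular A -> (0 < n)%N -> (n <= N)%N ->
  lt_mul A B n k = \sum_(1 <= j < N.+1) A n j * B j k.
Proof.
move=> Alt n0 leN; rewrite (big_cat_nat (n := n.+1)) //= [X in _ + X]big1_seq.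
  by rewrite addr0.
by move=> j /=; rewrite mem_index_iota => /andP [ltnj _]; rewrite Alt ?mul0r.
Qed.

(** The inner sum stops at j; triangularity of B extends it to n, and the two sums can then be
    exchanged. C may be a column vector u, encoded as [fun j _ => u j]. *)
Lemma lt_mulA A B C n k : lower_triangular B ->
  lt_mul A (lt_mul B C) n k = lt_mul (lt_mul A B) C n k.
Proof.
move=> Blt; rewrite {1 3}/lt_mul.
transitivity (\sum_(1 <= j < n.+1) \sum_(1 <= i < n.+1) A n j * (B j i * C i k)).
  apply: eq_big_nat => j /andP [j0 jn].
  by rewrite (lt_mul_widen _ _ Blt j0 jn) mulr_sumr.
rewrite exchange_big /=; apply: eq_bigr => i _.
by rewrite mulr_suml; apply: eq_bigr => j _; rewrite mulrA.
Qed.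

Lemma lt_mul_eqr A B C n k : (0 < k)%N -> lt_eq B C ->
  lt_mul A B n k = lt_mul A C n k.
Proof. by move=> k0 BC; apply: eq_big_nat => j /andP [j0 _]; rewrite BC. Qed.

Lemma lt_mul_eql A B C n k : (0 < n)%N -> lt_eq A B ->
  lt_mul A C n k = lt_mul B C n k.
Proof. by move=> n0 AB; apply: eq_big_nat => j /andP [j0 _]; rewrite AB. Qed.

Lemma lt_mul_diagl h B n k : (0 < n)%N -> lt_mul (lt_diag h) B n k = h n * B n k.
Proof.
move=> n0; rewrite /lt_mul (bigD1_seq n) ?iota_uniq ?mem_index_iota ?n0 ?ltnS//=.
rewrite /lt_diag eqxx mul1r big1 ?addr0 // => j.
by rewrite eq_sym => /negPf ->; rewrite !mul0r.
Qed.

Lemma lt_mul1l B n k : (0 < n)%N -> lt_mul lt_one B n k = B n k.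
Proof.
move=> n0; rewrite -[RHS]mul1r -(lt_mul_diagl (fun=> 1)) //.
by apply: eq_bigr => j _; rewrite /lt_diag mulr1.
Qed.

Lemma lt_mul1r A n k : lower_triangular A -> (0 < n)%N -> (0 < k)%N ->
  lt_mul A lt_one n k = A n k.
Proof.
(* The bound [maxn n k] puts the index k into the range even when n < k. *)
move=> Alt n0 k0; rewrite (lt_mul_widen _ _ Alt n0 (leq_maxl n k)).
rewrite (bigD1_seq k) ?iota_uniq ?mem_index_iota ?k0 ?ltnS ?leq_maxr //=.
rewrite /lt_one eqxx mulr1 big1 ?addr0 // => j.
by move=> /negPf ->; rewrite !mulr0.
Qed.

Lemma lt_mul_lower A B : lower_triangular A -> lower_triangular B ->
  lower_triangular (lt_mul A B).
Proof.
move=> Alt Blt n k n0 nk; apply: big1_seq => j /=.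
rewrite mem_index_iota => /andP [j0 jn].
by rewrite Blt ?mulr0 // (leq_ltn_trans _ nk).
Qed.

Lemma lt_diag_lower h : lower_triangular (lt_diag h).
Proof. by move=> n k _ nk; rewrite /lt_diag ltn_eqF // mul0r. Qed.

Lemma lt_diag_inverse h : (forall n, (0 < n)%N -> h n != 0) ->
  lt_is_inverse (lt_diag h) (lt_diag (fun n => (h n)^-1)).
Proof.
move=> h0; split; first exact: lt_diag_lower.
move=> n k n0 k0; rewrite !lt_mul_diagl // /lt_diag.
by rewrite !(mulrCA _ _%:R) mulfV ?mulVf ?mulr1 ?h0.
Qed.

(** Associativity brings A and B together. With C a column vector, this is inversion of a linear
    relation between sequences, the form in which it serves for Moebius inversion and for division
    by (q;q)_oo. *)
Lemma lt_mulK A B C n k : lower_triangular A -> lt_is_inverse A B ->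
    (0 < n)%N -> (0 < k)%N ->
  lt_mul A (lt_mul B C) n k = C n k /\ lt_mul B (lt_mul A C) n k = C n k.
Proof.
move=> Alt [Blt AB] n0 k0; rewrite !lt_mulA //; split; rewrite -[RHS]lt_mul1l //;
  by apply: lt_mul_eql => // i j i0 j0; case: (AB i j).
Qed.

Lemma lt_mul_inverse A A' B B' :
    lower_triangular A -> lower_triangular B ->
    lt_is_inverse A A' -> lt_is_inverse B B' ->
  lt_is_inverse (lt_mul A B) (lt_mul B' A').
Proof.
move=> Alt Blt AA' BB'; have [A'lt AA'1] := AA'; have [B'lt BB'1] := BB'.
split=> [|n k n0 k0]; first exact: lt_mul_lower.
rewrite -!lt_mulA //; split.
  rewrite (lt_mul_eqr _ (C := A')) //; first by case: (AA'1 n k).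
  by move=> i j i0 j0; case: (lt_mulK A' Blt BB' i0 j0).
rewrite (lt_mul_eqr _ (C := B)) //; first by case: (BB'1 n k).
by move=> i j i0 j0; case: (lt_mulK B Alt AA' i0 j0).
Qed.

(** Both sides equal B (A C). This carries a formula found for one inverse over to any other. *)
Lemma lt_inverse_unique A B C : lower_triangular A ->
  lt_is_inverse A B -> lt_is_inverse A C -> lt_eq B C.
Proof.
move=> Alt AB [_ AC] n k n0 k0; have [Blt _] := AB.
have [_ <-] := lt_mulK C Alt AB n0 k0; rewrite -(lt_mul1r Blt) //.
by apply: lt_mul_eqr => // i j i0 j0; case: (AC i j).
Qed.

Lemma lt_is_inverse_eq A A' B : lt_eq A A' -> lt_is_inverse A B ->
  lt_is_inverse A' B.
Proof.
move=> AA' [Blt AB]; split=> // n k n0 k0; have [ABnk BAnk] := AB n k n0 k0.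
by rewrite -(lt_mul_eql _ _ n0 AA') -(lt_mul_eqr _ _ k0 AA').
Qed.

End LowerTriangular.

(** * Formal power series and Toeplitz matrices *)

Section PowerSeries.

Variable F : fieldType.
Implicit Types a b c : fps F.

Definition toeplitz a (n k : nat) : F := if (k <= n)%N then a (n - k)%N else 0.

Lemma toeplitz_lower a : lower_triangular (toeplitz a).
Proof. by move=> n k _ nk; rewrite /toeplitz leqNgt nk. Qed.

Lemma fps_mulC a b : fps_mul a b =1 fps_mul b a.
Proof.
move=> n; rewrite /fps_mul (reindex_inj rev_ord_inj) /=.
by apply: eq_bigr => i _; rewrite subSS subKn 1?mulrC // -ltnS.
Qed.

Lemma eq_fps_mul a a' b b' n :
    (forall i, (i <= n)%N -> a i = a' i) -> (forall i, (i <= n)%N -> b i = b' i) ->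
  fps_mul a b n = fps_mul a' b' n.
Proof.
by move=> aa' bb'; apply: eq_bigr => i _; rewrite aa' ?bb' ?leq_subr // -ltnS.
Qed.

Lemma toeplitz_mul a b n k : (0 < n)%N -> (0 < k)%N ->
  lt_mul (toeplitz a) (toeplitz b) n k = toeplitz (fps_mul a b) n k.
Proof.
move=> n0 k0; rewrite {3}/toeplitz; case: leqP => [kn|nk]; last first.
  by apply: lt_mul_lower => //; apply: toeplitz_lower.
rewrite fps_mulC /lt_mul (big_cat_nat (n := k)) //=; last exact: leqW.
rewrite big1_seq ?add0r => [|j /=]; last first.
  rewrite mem_index_iota => /andP [j0 jk].
  by rewrite /toeplitz [(k <= j)%N]leqNgt jk mulr0.
(* Only k <= j <= n contributes; the substitution j = i + k turns a (n - j) b (j - k) into a term of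
   the Cauchy product at n - k. *)
rewrite -{1}[k]add0n big_addn subSn // big_mkord; apply: eq_bigr => i _.
have ile : (i + k <= n)%N by have := ltn_ord i; rewrite ltnS leq_subRL // addnC.
by rewrite /toeplitz ile leq_addl addnK mulrC subnDA subnAC.
Qed.

(** Coefficient n of a series is the entry (n + 1, 1) of its Toeplitz matrix, so associativity is
    inherited from matrix products. *)
Lemma fps_mulA a b c : fps_mul a (fps_mul b c) =1 fps_mul (fps_mul a b) c.
Proof.
move=> n; have toepE d : d n = toeplitz d n.+1 1 by rewrite /toeplitz subn1.
rewrite !{}toepE -!toeplitz_mul //.
rewrite (lt_mul_eqr _ _ _ (C := lt_mul (toeplitz b) (toeplitz c))) //; last first.
  by move=> i j i0 j0; rewrite toeplitz_mul.
rewrite lt_mulA; last exact: toeplitz_lower.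
by apply: lt_mul_eql => // i j i0 j0; rewrite toeplitz_mul.
Qed.

Lemma fps_mul1 a : fps_mul (fps_of_poly 1) a =1 a.
Proof.
move=> n; rewrite /fps_mul big_ord_recl /fps_of_poly coef1 subn0 mul1r.
by rewrite big1 ?addr0 // => i _; rewrite coef1 mul0r.
Qed.

Lemma fps_mulBl (p q : {poly F}) a n :
  fps_mul (fps_of_poly (p - q)) a n =
  fps_mul (fps_of_poly p) a n - fps_mul (fps_of_poly q) a n.
Proof.
by rewrite -sumrB; apply: eq_bigr => i _; rewrite /fps_of_poly coefB mulrBl.
Qed.

Lemma fps_mulXn k a n :
  fps_mul (fps_of_poly 'X^k) a n = if (k <= n)%N then a (n - k)%N else 0.
Proof.
case: leqP => [kn|nk]; last first.
  apply: big1 => i _; rewrite /fps_of_poly coefXn ltn_eqF ?mul0r //.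
  by rewrite (leq_trans _ nk).
have lt_k : (k < n.+1)%N by [].
rewrite /fps_mul (bigD1 (Ordinal lt_k)) //= /fps_of_poly coefXn eqxx mul1r.
rewrite big1 ?addr0 // => i; rewrite -val_eqE coefXn /= => /negPf ->.
by rewrite mul0r.
Qed.

Lemma fps_inv_unique a b : a 0%N != 0 -> fps_mul a b =1 fps_of_poly 1 ->
  fps_inv a =1 b.
Proof.
move=> a0 ab n; rewrite -[RHS]fps_mul1.
rewrite -(eq_fps_mul (fun i _ => fps_mulV a0 i) (fun _ _ => erefl)).
rewrite (eq_fps_mul (fun i _ => fps_mulC _ _ i) (fun _ _ => erefl)).
rewrite -fps_mulA (eq_fps_mul (fun _ _ => erefl) (fun i _ => ab i)).
by rewrite fps_mulC fps_mul1.
Qed.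

(** The zero constant term of [gen_series] removes index 0, leaving a Toeplitz matrix applied to the
    column u. Column 1 is an arbitrary choice, since the encoded vector ignores its column index. *)
Lemma fps_mul_gen_series a (u : nat -> F) n : (0 < n)%N ->
  fps_mul a (gen_series u) n = lt_mul (toeplitz a) (fun j _ => u j) n 1.
Proof.
move=> n0; rewrite fps_mulC /fps_mul big_ord_recl mul0r add0r /lt_mul.
rewrite big_add1 big_mkord; apply: eq_bigr => i _.
by rewrite /toeplitz ltn_ord /gen_series mulrC.
Qed.

Lemma toeplitz_inverse a b : fps_mul a b =1 fps_of_poly 1 ->
  lt_is_inverse (toeplitz a) (toeplitz b).
Proof.
move=> ab; split; first exact: toeplitz_lower.
have toep1 c n k : (forall i, c i = fps_of_poly 1 i) ->
    toeplitz c n k = (n == k)%:R.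
  move=> c1; rewrite /toeplitz c1 /fps_of_poly coef1 subn_eq0 eqn_leq andbC.
  by case: leqP.
move=> n k n0 k0; rewrite !toeplitz_mul // !toep1 // => i.
by rewrite fps_mulC ab.
Qed.

(** Multiplying the indicator of the multiples of k by 1 - q^k cancels every coefficient of degree
    at least k, because k divides n iff it divides n - k; below k only degree 0 survives. *)
Lemma fps_inv_geom k : (0 < k)%N ->
  fps_inv (fps_of_poly (1 - 'X^k)) =1 fun n => (k %| n)%N%:R :> F.
Proof.
move=> k0; apply: fps_inv_unique.
  by rewrite /fps_of_poly coefB coef1 coefXn (ltn_eqF k0) subr0 oner_eq0.
move=> n; rewrite fps_mulBl fps_mul1 fps_mulXn /fps_of_poly coef1.
case: leqP => [kn | nk].
  by rewrite -{1}(subnK kn) dvdn_addl // subrr gtn_eqF // (leq_trans k0).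
rewrite subr0; case: n nk => [|n] nk; first by rewrite dvdn0.
by rewrite gtnNdvd.
Qed.

(** Shifting the indicator of the multiples of k by k changes it at 0 only. *)
Lemma lambert_termE k n : (0 < k)%N -> (0 < n)%N ->
  lambert_term F k n = (k %| n)%N%:R.
Proof.
move=> k0 n0; rewrite /lambert_term fps_mulXn; case: leqP => [kn|nk].
  by rewrite fps_inv_geom // -[in RHS](subnK kn) dvdn_addl.
by rewrite gtnNdvd.
Qed.

End PowerSeries.

(** * Moebius inversion *)

Section Moebius.

Variable F : fieldType.

Lemma moebius_sqr p d : prime p -> (1 < logn p d)%N -> moebius F d = 0.
Proof.
move=> p_pr log_gt1; rewrite /moebius; case: allP => // /(_ p).
rewrite -logn_gt0 (ltnW log_gt1) => /(_ isT) /eqP log1.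
by rewrite log1 in log_gt1.
Qed.

Lemma moebius_primeM p d : prime p -> (0 < d)%N -> ~~ (p %| d)%N ->
  moebius F (p * d) = - moebius F d.
Proof.
move=> p_pr d0 pd; have p0 := prime_gt0 p_pr.
have pprimes : p \notin primes d by rewrite mem_primes (negPf pd) !andbF.
have perm_pd : perm_eq (primes (p * d)) (p :: primes d).
  apply: uniq_perm; rewrite /= ?primes_uniq ?pprimes //.
  by move=> q; rewrite primesM // primes_prime // !inE.
rewrite /moebius (perm_all _ perm_pd) (perm_size perm_pd) /=.
rewrite lognM // logn_prime // eqxx lognE (negPf pd) !andbF addn0 eqxx /=.
have -> : all (fun q => logn q (p * d) == 1%N) (primes d) =
          all (fun q => logn q d == 1%N) (primes d).
  apply: eq_in_all => q qd; rewrite lognM // logn_prime //.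
  by have [qp|//] := eqVneq q p; rewrite -qp qd in pprimes.
by case: ifP; rewrite ?oppr0 // exprS mulN1r.
Qed.

(* For a prime p dividing n, d |-> p * d pairs the divisors of n prime to p with
   those exactly divisible by p, and reverses the sign of moebius. *)
Lemma sum_moebius n : (0 < n)%N ->
  \sum_(d <- divisors n) moebius F d = (n == 1%N)%:R.
Proof.
move=> n0; have [->|n1] := eqVneq n 1%N; first by rewrite big_seq1.
set p := pdiv n; have p_pr : prime p.
  by apply: pdiv_prime; rewrite ltn_neqAle eq_sym n1.
have p0 := prime_gt0 p_pr; have pn : (p %| n)%N := pdiv_dvd n.
have dgt0 d : (d %| n)%N -> (0 < d)%N by move/dvdn_gt0; apply.
(* Three classes of divisors: prime to p, exactly divisible by p, and divisible by p^2. The last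
   contributes 0. *)
rewrite (bigID (fun d => p %| d)%N) /=.
rewrite [X in X + _](bigID (fun d => logn p d == 1%N)) /=.
rewrite [X in _ + X + _]big1_seq => [|d /andP [/andP [pd logd]]]; last first.
  rewrite -dvdn_divisors // => /dgt0 d0; apply: (moebius_sqr p_pr).
  by rewrite ltn_neqAle eq_sym logd logn_gt0 mem_primes p_pr d0.
rewrite addr0 -big_filter -[X in _ + X]big_filter.
have perm_p : perm_eq
    [seq d <- divisors n | (p %| d)%N && (logn p d == 1%N)]
    [seq (p * d)%N | d <- [seq d <- divisors n | ~~ (p %| d)%N]].
  apply: uniq_perm; rewrite ?map_inj_uniq ?filter_uniq ?divisors_uniq //.
    by move=> x y /eqP; rewrite eqn_pmul2l // => /eqP.
  move=> d; rewrite mem_filter -dvdn_divisors //; apply/andP/mapP.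
    case=> /andP [/dvdnP [e de] logd] dn; exists e; last by rewrite mulnC.
    have e0 : (0 < e)%N by move: (dgt0 d dn); rewrite de muln_gt0 => /andP [].
    rewrite mem_filter -dvdn_divisors // (dvdn_trans _ dn) ?de ?dvdn_mulr // andbT.
    move: logd; rewrite de lognM // (logn_prime _ p_pr) eqxx addn1 eqSS => /eqP log0.
    by apply/negP => pe; have := logn_gt0 p e; rewrite log0 mem_primes p_pr e0 pe.
  case=> e; rewrite mem_filter -dvdn_divisors // => /andP [pe en] ->.
  have e0 := dgt0 e en.
  rewrite dvdn_mulr // lognM // (logn_prime _ p_pr) eqxx lognE (negPf pe) !andbF.
  by split; rewrite // Gauss_dvd ?pn ?prime_coprime.
rewrite (perm_big _ perm_p) big_map /= -big_split /= big1_seq // => d.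
rewrite mem_filter -dvdn_divisors // => /= /andP [pd dn].
by rewrite moebius_primeM ?addNr ?dgt0.
Qed.

Lemma big_divisors n (u : nat -> F) : (0 < n)%N ->
  \sum_(d <- divisors n) u d = \sum_(1 <= d < n.+1) (d %| n)%N%:R * u d.
Proof.
move=> n0.
have perm_n : perm_eq (divisors n) [seq d <- index_iota 1 n.+1 | d %| n]%N.
  apply: uniq_perm; rewrite ?divisors_uniq ?filter_uniq ?iota_uniq // => d.
  rewrite mem_filter mem_index_iota -dvdn_divisors //.
  by case: (boolP (d %| n)%N) => //= dn; rewrite ltnS (dvdn_gt0 n0 dn) (dvdn_leq n0 dn).
rewrite (perm_big _ perm_n) big_filter big_mkcond; apply: eq_bigr => d _.
by case: ifP; rewrite ?mul1r ?mul0r.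
Qed.

Lemma sum_divisors_multiples m k (u : nat -> F) : (0 < m)%N -> (0 < k)%N ->
  \sum_(d <- divisors (m * k)) (k %| d)%N%:R * u d =
  \sum_(e <- divisors m) u (e * k)%N.
Proof.
move=> m0 k0; have mk0 : (0 < m * k)%N by rewrite muln_gt0 m0.
rewrite (bigID (fun d => k %| d)%N) /= [X in _ + X]big1 ?addr0; last first.
  by move=> d /negPf ->; rewrite mul0r.
rewrite -big_filter.
have perm_k : perm_eq [seq d <- divisors (m * k) | (k %| d)%N]
                      [seq (e * k)%N | e <- divisors m].
  apply: uniq_perm; rewrite ?map_inj_uniq ?filter_uniq ?divisors_uniq //.
    by move=> x y /eqP; rewrite eqn_pmul2r // => /eqP.
  move=> d; rewrite mem_filter -dvdn_divisors //; apply/andP/mapP.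
    by case=> /dvdnP [e ->]; exists e; rewrite // -dvdn_divisors // -(dvdn_pmul2r k0).
  by case=> e; rewrite -dvdn_divisors // => em ->; rewrite dvdn_mull ?dvdn_pmul2r.
rewrite (perm_big _ perm_k) big_map; apply: eq_bigr => e _.
by rewrite dvdn_mull ?mul1r.
Qed.

Lemma sum_divisors_rev n (u : nat -> F) : (0 < n)%N ->
  \sum_(d <- divisors n) u (n %/ d)%N = \sum_(d <- divisors n) u d.
Proof.
move=> n0; rewrite -(big_map (fun d => n %/ d)%N xpredT).
have divK d : (d %| n)%N -> (n %/ (n %/ d) = d)%N.
  move=> dn; have d0 := dvdn_gt0 n0 dn.
  by rewrite -{1}(divnK dn) mulKn // divn_gt0 // dvdn_leq.
apply: perm_big; apply: uniq_perm; rewrite ?divisors_uniq //.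
  rewrite map_inj_in_uniq ?divisors_uniq // => x y.
  by rewrite -!dvdn_divisors // => /divK {2}<- /divK {2}<- ->.
move=> d; rewrite -dvdn_divisors //; apply/mapP/idP => [[e]|dn].
  by rewrite -dvdn_divisors // => en ->; rewrite dvdn_div.
by exists (n %/ d)%N; rewrite ?divK // -dvdn_divisors // dvdn_div.
Qed.

Definition moebius_mx (n k : nat) : F := (k %| n)%N%:R * moebius F (n %/ k).

Lemma T_Div_lower : lower_triangular (T_Div F).
Proof. by move=> n k n0 nk; rewrite /T_Div gtnNdvd. Qed.

(** If k does not divide n, no divisor of n is a multiple of k. If n = m k, the two products are the
    sums of mu(e) and of mu(m/e) over e | m, and both reduce to [sum_moebius]. *)
Lemma T_Div_inverse : lt_is_inverse (T_Div F) moebius_mx.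
Proof.
split=> [n k n0 nk|n k n0 k0]; first by rewrite /moebius_mx gtnNdvd ?mul0r.
have -> : lt_mul (T_Div F) moebius_mx n k =
    \sum_(d <- divisors n) (k %| d)%N%:R * moebius F (d %/ k).
  by rewrite big_divisors.
have -> : lt_mul moebius_mx (T_Div F) n k =
    \sum_(d <- divisors n) (k %| d)%N%:R * moebius F (n %/ d).
  rewrite big_divisors //; apply: eq_bigr => d _.
  by rewrite -mulrA [_ * T_Div F _ _]mulrC.
have [/dvdnP [m nE]|kn] := boolP (k %| n)%N; last first.
  have -> : n == k = false by apply: contraNF kn => /eqP ->.
  have kd0 d : d \in divisors n -> (k %| d)%N = false.
    rewrite -dvdn_divisors // => dn; apply: contraNF kn => kd.
    exact: dvdn_trans dn.
  by split; apply: big1_seq => d /= /kd0 ->; rewrite mul0r.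
have m0 : (0 < m)%N by move: n0; rewrite nE muln_gt0 => /andP [].
have mkk : (m * k == k)%N = (m == 1)%N by rewrite -{2}[k]mul1n eqn_pmul2r.
rewrite nE !sum_divisors_multiples // mkk -sum_moebius //.
split; first by apply: eq_bigr => e _; rewrite mulnK.
by rewrite -[RHS]sum_divisors_rev //; apply: eq_bigr => e _; rewrite divnMr.
Qed.

Lemma div_sumE (u : nat -> F) n k : (0 < n)%N ->
  div_sum u n = lt_mul (T_Div F) (fun j _ => u j) n k.
Proof. by move=> n0; rewrite /div_sum big_divisors. Qed.

Lemma lambertE (u : nat -> F) n : (0 < n)%N -> lambert u n = div_sum u n.
Proof.
move=> n0; rewrite /div_sum big_divisors //; apply: eq_big_nat => d /andP [d0 _].
by rewrite lambert_termE // mulrC.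
Qed.

(** [a_fg] is the Moebius matrix applied to the product of the two divisor sums, and taking Lambert
    coefficients applies the divisibility matrix, which undoes it. *)
Lemma lambert_a_fg (f g : nat -> F) n : (0 < n)%N ->
  lambert (a_fg f g) n = div_sum f n * div_sum g n.
Proof.
move=> n0; rewrite lambertE // (div_sumE _ 1) //.
have [<- _] := lt_mulK (fun j _ => div_sum f j * div_sum g j) T_Div_lower
  T_Div_inverse n0 (ltn0Sn 0).
apply: lt_mul_eqr => // d k d0 _; rewrite /a_fg big_divisors //.
by apply: eq_bigr => j _; rewrite /moebius_mx -[RHS]mulrA [moebius _ _ * _]mulrC.
Qed.

End Moebius.

(** * The generating function of the partition numbers *)

Section Partitions.

(** The bound m on the parts corresponds to the truncation of (q;q)_oo to its first m factors and
    allows induction on m. *)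
Definition bounded_partition (m n : nat) (s : seq nat) : bool :=
  is_partition n s && all (geq m) s.

Definition partitions (m n : nat) : seq (seq nat) :=
  [seq [seq val i | i <- s] | s : n.-bseq 'I_n.+1 in
     [pred s : n.-bseq 'I_n.+1 | bounded_partition m n [seq val i | i <- s]]].

Lemma mem_partitions m n s : (s \in partitions m n) = bounded_partition m n s.
Proof.
apply/imageP/idP => [[t tP ->] // | sP].
have /andP [/partition_bounded [t tE] _] := sP.
by exists t; rewrite ?inE tE.
Qed.

Lemma partitions_uniq m n : uniq (partitions m n).
Proof.
rewrite map_inj_uniq ?enum_uniq // => s t /(inj_map val_inj) st.
exact: val_inj.
Qed.

Lemma part_leq_sumn (s : seq nat) x : x \in s -> (x <= sumn s)%N.
Proof.
elim: s => //= y s IHs; rewrite inE => /predU1P [-> | /IHs lex].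
  exact: leq_addr.
exact: leq_trans lex (leq_addl _ _).
Qed.

Lemma npart_bounded m n : (n <= m)%N -> npart n = size (partitions m n).
Proof.
move=> nm; rewrite /npart size_image; apply: eq_card => s.
rewrite !inE /bounded_partition; case: (boolP (is_partition _ _)) => //= sP.
apply/esym/allP => x xs; have /and3P [_ _ /eqP sum_s] := sP.
by apply: leq_trans nm; rewrite -sum_s part_leq_sumn.
Qed.

Lemma size_partitions0 n : size (partitions 0 n) = (n == 0%N).
Proof.
have perm0 : perm_eq (partitions 0 n) (nseq (n == 0%N) [::]).
  apply: uniq_perm; rewrite ?partitions_uniq //; first by case: eqP.
  move=> s; rewrite mem_partitions mem_nseq.
  case: s => [|x s]; rewrite /bounded_partition /is_partition /=.
    by rewrite andbT andbC eq_sym; case: (n == 0%N).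
  by case: x => [|x]; rewrite ?inE ?eqxx ?andbF.
by rewrite (perm_size perm0) size_nseq.
Qed.

(** Deleting one part m + 1 leaves the bound unchanged, since that part may be repeated; the order
    condition on the head is the bound already required of the tail. *)
Lemma bounded_partition_cons m n s :
  bounded_partition m.+1 n (m.+1 :: s) =
  (m.+1 <= n)%N && bounded_partition m.+1 (n - m.+1) s.
Proof.
rewrite /bounded_partition /is_partition /= inE /= ltnSn /=.
rewrite path_sortedE; last by move=> x y z yx zx; apply: leq_trans zx yx.
have [mn|nm] /= := ltnP m n.
  by rewrite -[X in _ == X](subnKC mn) eqn_add2l; case: (all _ s); rewrite /= ?andbT ?andbF.
suff -> : (m.+1 + sumn s == n)%N = false by rewrite !andbF.
by apply: gtn_eqF; rewrite addSn ltnS (leq_trans nm) // leq_addr.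
Qed.

(** The parts decrease, so the head bounds all the others. *)
Lemma bounded_partition_cons_lt m n x s : (x <= m)%N ->
  bounded_partition m.+1 n (x :: s) = bounded_partition m n (x :: s).
Proof.
move=> xm; rewrite /bounded_partition; case: (boolP (is_partition _ _)) => //=.
case/and3P => /= sP _ _; rewrite xm leqW //=.
move: sP; rewrite path_sortedE; last by move=> a b c ba cb; apply: leq_trans cb ba.
case/andP => /allP sx _; apply/allP/allP => _ y /sx /= yx.
  exact: leq_trans xm.
by rewrite leqW // (leq_trans yx).
Qed.

(* A partition with parts at most m + 1 either has no part m + 1, or starts with
   such a part. *)
Lemma size_partitionsS m n :
  size (partitions m.+1 n) = (size (partitions m n) +
    if m.+1 <= n then size (partitions m.+1 (n - m.+1)) else 0)%N.
Proof.
have permS : perm_eq (partitions m.+1 n) (partitions m n ++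
    [seq m.+1 :: s | s <- if m.+1 <= n then partitions m.+1 (n - m.+1) else [::]])%N.
  apply: uniq_perm; first exact: partitions_uniq.
    rewrite cat_uniq partitions_uniq map_inj_uniq => [/=|s t [] //].
    apply/andP; split; last by case: ifP; rewrite ?partitions_uniq.
    apply/hasPn => _ /mapP [s _ ->]; rewrite mem_partitions.
    by rewrite /bounded_partition /= ltnn andbF.
  move=> s; rewrite mem_cat !mem_partitions; case: s => [|x s].
    by rewrite orbC; case: mapP => [[]|].
  have [-> | xm] := eqVneq x m.+1.
    rewrite bounded_partition_cons [bounded_partition m _ _]andbC /= ltnn /=.
    rewrite mem_map => [|t u [] //].
    by case: leqP; rewrite ?mem_partitions.
  have -> : (x :: s \in [seq m.+1 :: t | t <-
      if m < n then partitions m.+1 (n - m.+1) else [::]])%N = false.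
    by apply/mapP => -[t _ [xE _]]; rewrite xE eqxx in xm.
  rewrite orbF; have [lexm | ltmx] := leqP x m.
    exact: bounded_partition_cons_lt.
  rewrite /bounded_partition /= [(x <= m)%N]leqNgt ltmx andbF.
  by rewrite leq_eqVlt ltnS (negPf xm) leqNgt ltmx andbF.
rewrite (perm_size permS) size_cat; congr (_ + _)%N; rewrite size_map.
by case: ifP.
Qed.

Variable F : fieldType.

Definition part_series : fps F := fun n => (npart n)%:R.

(** Induction on m: by [size_partitionsS], the factor 1 - q^(m+1) turns the series of partitions
    with parts at most m + 1 into the one for m. *)
Lemma prod_partitions m :
  fps_mul (fps_of_poly (\prod_(1 <= i < m.+1) (1 - 'X^i)))
          (fun n => (size (partitions m n))%:R : F) =1 fps_of_poly 1.
Proof.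
elim: m => [|m IHm] n.
  rewrite big_nil fps_mul1 size_partitions0 /fps_of_poly coef1.
  by case: eqP.
rewrite big_nat_recr //=.
have polyM (p q : {poly F}) i :
    fps_of_poly (p * q) i = fps_mul (fps_of_poly p) (fps_of_poly q) i.
  by rewrite /fps_of_poly coefM.
rewrite (eq_fps_mul (fun i _ => polyM _ _ i) (fun _ _ => erefl)) -fps_mulA -IHm.
apply: eq_fps_mul => // i _; rewrite fps_mulBl fps_mul1 fps_mulXn size_partitionsS.
by case: ifP => _; rewrite ?addn0 ?subr0 // natrD addrK.
Qed.

(** Up to degree n, neither the factors of index above n nor the parts above n matter, so the finite
    identity with m = n gives coefficient n. *)
Lemma qq_inf_part : fps_mul (qq_inf F) part_series =1 fps_of_poly 1.
Proof.
move=> n; rewrite -(prod_partitions n n); apply: eq_fps_mul => i le_in.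
  rewrite /qq_inf /fps_of_poly -(subnK le_in); elim: (n - i)%N => // k ->.
  rewrite addSn [in RHS]big_nat_recr //= mulrBr mulr1 coefB coefMXn.
  by rewrite ltnS leq_addl subr0.
by rewrite /part_series (npart_bounded le_in).
Qed.

Lemma fps_inv_qq_inf : fps_inv (qq_inf F) =1 part_series.
Proof.
apply: fps_inv_unique qq_inf_part.
by rewrite /qq_inf big_nil coef1 oner_eq0.
Qed.

End Partitions.

(** * The factorization matrix *)

Section Factorization.

Variables (F : fieldType) (f : nat -> F).

Let toep_inv := toeplitz_inverse (@qq_inf_part F).

Lemma s_mat_factor :
  lt_eq (lt_mul (toeplitz (qq_inf F)) (lt_mul (lt_diag (div_sum f)) (T_Div F)))
        (s_mat f).
Proof.
move=> n k n0 k0; rewrite /s_mat fps_mul_gen_series //.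
apply: eq_big_nat => j /andP [j0 _].
by rewrite lt_mul_diagl // [div_sum _ _ * _]mulrC.
Qed.

Lemma s_mat_lower : lower_triangular (s_mat f).
Proof.
move=> n k n0 nk; rewrite -s_mat_factor ?(leq_ltn_trans _ nk) //.
apply: lt_mul_lower => //; first exact: toeplitz_lower.
by apply: lt_mul_lower; [apply: lt_diag_lower | apply: T_Div_lower].
Qed.

Lemma fps_mul_inv_qq u n : (0 < n)%N ->
  fps_mul (fps_inv (qq_inf F)) (gen_series u) n =
  lt_mul (toeplitz (part_series F)) (fun j _ => u j) n 1.
Proof.
move=> n0; rewrite -fps_mul_gen_series //.
by apply: eq_fps_mul => // i _; rewrite fps_inv_qq_inf.
Qed.

Lemma s_mat_factorization : lambert_factorization f (s_mat f).
Proof.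
(* In degree 0 the Lambert sum is empty and [gen_series] has zero constant term. *)
move=> g [|n]; first by rewrite /lambert big_nil /fps_mul big_ord1 mulr0.
rewrite lambert_a_fg // fps_mul_inv_qq //.
set DT := lt_mul (lt_diag (div_sum f)) (T_Div F).
have DTlt : lower_triangular DT.
  by apply: lt_mul_lower; [apply: lt_diag_lower | apply: T_Div_lower].
set G := lt_mul DT (fun j _ => g j).
(* The column s g is T((q;q)_oo) G, so applying T(p) leaves G, whose entries are the products of the
   two divisor sums. *)
rewrite (lt_mul_eqr _ (C := lt_mul (toeplitz (qq_inf F)) G)) //.
  have [_ ->] := lt_mulK G (toeplitz_lower (qq_inf F)) toep_inv
    (ltn0Sn n) (ltn0Sn 0).
  by rewrite /G -lt_mulA ?lt_mul_diagl -?div_sumE //; apply: T_Div_lower.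
move=> m j m0 _; rewrite /G lt_mulA //.
by rewrite (lt_mul_eql _ _ m0 s_mat_factor).
Qed.

Lemma lambert_factorization_unique s t :
    lambert_factorization f s -> lambert_factorization f t ->
  forall n k, (0 < k)%N -> (k <= n)%N -> s n k = t n k.
Proof.
move=> fs ft n k k0 kn; have n0 := leq_trans k0 kn.
(* Testing against the indicator of k isolates column k: the row sum at n is the entry (n, k). *)
pose g (j : nat) : F := (j == k)%:R.
pose row r m : F := \sum_(1 <= j < m.+1) r m j * g j.
have rowE r : row r n = r n k.
  rewrite /row (bigD1_seq k) ?iota_uniq ?mem_index_iota ?k0 ?ltnS //=.
  by rewrite /g eqxx mulr1 big1 ?addr0 // => j /negPf ->; rewrite mulr0.
rewrite -!rowE.
(* Each column is written as T((q;q)_oo) applied to its image under T(p); that image is the Lambert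
   series of [a_fg f g], the same for s and t. *)
have [<- _] := lt_mulK (fun j _ => row s j) (toeplitz_lower (qq_inf F))
  toep_inv n0 (ltn0Sn 0).
have [<- _] := lt_mulK (fun j _ => row t j) (toeplitz_lower (qq_inf F))
  toep_inv n0 (ltn0Sn 0).
apply: eq_big_nat => m /andP [m0 _]; congr (_ * _).
by rewrite -!fps_mul_inv_qq // -[LHS]fs -[RHS]ft.
Qed.

Hypothesis f_neq0 : forall n, (0 < n)%N -> div_sum f n != 0.

Definition s_mat_inv (n k : nat) : F :=
  \sum_(d <- divisors n)
     (npartz (d%:Z - k%:Z))%:R / div_sum f d * moebius F (n %/ d).

Lemma s_mat_inverse : exists2 B, lt_is_inverse (s_mat f) B & lt_eq B s_mat_inv.
Proof.
exists (lt_mul (lt_mul (moebius_mx F) (lt_diag (fun n => (div_sum f n)^-1)))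
               (toeplitz (part_series F))).
  apply: (lt_is_inverse_eq s_mat_factor); apply: lt_mul_inverse => //.
  - exact: toeplitz_lower.
  - by apply: lt_mul_lower; [apply: lt_diag_lower | apply: T_Div_lower].
  apply: lt_mul_inverse; [exact: lt_diag_lower | exact: T_Div_lower | |].
    exact: lt_diag_inverse.
  exact: T_Div_inverse.
move=> n k n0 k0; rewrite -lt_mulA; last exact: lt_diag_lower.
rewrite /s_mat_inv big_divisors //; apply: eq_big_nat => d /andP [d0 _].
rewrite lt_mul_diagl // /moebius_mx -mulrA; congr (_ * _).
rewrite mulrC; congr (_ * _); rewrite mulrC; congr (_ / _).
rewrite /toeplitz /part_series; case: leqP => [kd|dk]; first by rewrite subzn.
(* For d < k, writing k - d as a successor makes the integer d - k reduce to a [Negz], where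
   [npartz] is 0. *)
by rewrite -opprB (subzn (ltnW dk)) -(prednK (n := k - d)) ?subn_gt0.
Qed.

End Factorization.

Theorem mainTheorem2 (R : realType) (f : nat -> R[i])
    (hf : forall n : nat, (0 < n)%N -> div_sum f n != 0) :
  [/\ lambert_factorization f (s_mat f),
      (forall t : nat -> nat -> R[i], lambert_factorization f t ->
         forall n k : nat, (0 < k)%N -> (k <= n)%N -> t n k = s_mat f n k),
      lt_invertible (s_mat f)
    & forall t : nat -> nat -> R[i], lt_is_inverse (s_mat f) t ->
        forall n k : nat, (0 < n)%N -> (0 < k)%N ->
          t n k = \sum_(d <- divisors n)
                    (npartz (d%:Z - k%:Z))%:R / div_sum f d * moebius _ (n %/ d)].
Proof.
have [B sB BE] := s_mat_inverse hf.
split.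
- exact: s_mat_factorization.
- move=> t ft; exact: lambert_factorization_unique ft (s_mat_factorization f).
- by split; [exact: s_mat_lower | exists B].
- move=> t st n k n0 k0.
  by rewrite (lt_inverse_unique (s_mat_lower f) st sB) // BE.
Qed.
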